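(* Let $\beta$ be a $3$-braid word with Schreier vector of length $>2$. Then the following are equivalent: (a) the closed braid diagram $\hat\beta$ is semiadequate; (b) $\beta$ has minimal length in its conjugacy class, i.e. no word in $\sigma_1^{\pm1},\sigma_2^{\pm1}$ representing a conjugate in $B_3$ of the braid represented by $\beta$ has fewer letters than $\beta$; (c) some $\gamma\in\{\beta,\bar\beta\}$ satisfies one of the following two conditions: (1) $\gamma$ is positive; or (2) $\gamma$ does not contain $\sigma_1^{-1}\sigma_2^{-1}\sigma_1^{-1}$ or $\sigma_2^{-1}\sigma_1^{-1}\sigma_2^{-1}$ as a (contiguous, cyclically read) subword, and positive entries in the Schreier vector of $\gamma$ are isolated, i.e. the entries cyclically before and after every positive entry are negative.
   Context: $B_3$ is the 3-strand braid group with Artin generators $\sigma_1,\sigma_2$. A $3$-braid word is written $\beta=\prod_{j=1}^{k}\sigma_{p_j}^{q_j}$ with $q_j\neq 0$ and the $p_j$ alternating (cyclically) between $1$ and $2$; the vector $(q_1,\dots,q_k)$, regarded up to cyclic permutation, is its Schreier vector, and $k$ (even) its length. The word $\beta$ has $\sum_j|q_j|$ letters and gives under closure a link diagram $\hat\beta$ with that many crossings. A word is positive if all $q_j>0$. $\bar\beta$ denotes the mirror image word, obtained by replacing each $\sigma_i^{\pm1}$ by $\sigma_i^{\mp1}$. A link diagram $D$ is $A$-adequate (resp. $B$-adequate) if no crossing, once $A$-spliced (resp. $B$-spliced), has the same loop of the $A$-state (resp. $B$-state) on both sides of the spliced spot; here the $A$-splicing joins the two corners of a crossing passed by the overcrossing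 strand when rotated counterclockwise towards the undercrossing strand, the $B$-splicing joins the other two corners, and the $A$-state ($B$-state) is the collection of loops obtained by $A$-splicing ($B$-splicing) all crossings. $D$ is semiadequate if it is $A$-adequate or $B$-adequate. *)

(* Defs.v *)
From mathcomp Require Import all_boot all_order all_algebra.

Set Implicit Arguments.
Unset Strict Implicit.
Unset Printing Implicit Defensive.

Import Order.TTheory GRing.Theory Num.Theory.

(* Link diagrams are given by planar diagram codes.  The four edges at a
   crossing are listed counterclockwise, starting from an end of the undercrossing
   strand, so [xe0], [xe2] are undercrossing and [xe1], [xe3] are overcrossing.
   A join (e, f) is a bivalent point at which an end of e meets an end of f; in
   a code of a diagram every edge occurs twice in crossings and joins together. *)
Record xing (E : Type) := Xing { xe0 : E; xe1 : E; xe2 : E; xe3 : E }.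

Record diagram := Diagram {
  edge : finType;
  crossings : seq (xing edge);
  joins : seq (edge * edge)
}.

Inductive splicing := A_splicing | B_splicing.

(* Rotated counterclockwise towards the undercrossing strand, the overcrossing
   strand passes the corners (xe1, xe2) and (xe3, xe0).  Joining these two
   corners leaves one arc from xe0 to xe1 and one from xe2 to xe3. *)
Definition spliced_arcs (E : Type) (k : splicing) (x : xing E) : seq (E * E) :=
  match k with
  | A_splicing => [:: (xe0 x, xe1 x); (xe2 x, xe3 x)]
  | B_splicing => [:: (xe1 x, xe2 x); (xe3 x, xe0 x)]
  end.

Definition state_arcs (D : diagram) (k : splicing) : seq (edge D * edge D) :=
  joins D ++ flatten [seq spliced_arcs k x | x <- crossings D].

Definition state_adj (D : diagram) (k : splicing) : rel (edge D) :=
  fun e f => ((e, f) \in state_arcs D k) || ((f, e) \in state_arcs D k).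

(* The loops of the state are the connected components of [state_adj]. *)
Definition same_loop (D : diagram) (k : splicing) : rel (edge D) :=
  connect (@state_adj D k).

(* For both splicings, xe0 and xe2 lie on opposite sides of the spliced spot. *)
Definition adequate (k : splicing) (D : diagram) : bool :=
  all (fun x => ~~ same_loop k (xe0 x) (xe2 x)) (crossings D).

Definition semiadequate (D : diagram) : bool :=
  adequate A_splicing D || adequate B_splicing D.

(* The letter (i, true) is the Artin generator crossing the strands at
   positions i and i + 1 (counted from 0), and (i, false) is its inverse. *)
Definition letter : Type := ('I_2 * bool)%type.
Definition word : Type := seq letter.

Definition sigma1 : letter := (ord0, true).
Definition sigma2 : letter := (ord_max, true).

Definition inv_letter (a : letter) : letter := (a.1, ~~ a.2).
Definition inv_word (w : word) : word := rev (map inv_letter w).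
Definition mirror (w : word) : word := map inv_letter w.

(* Equality in B_3 of the braids represented by two words: the congruence
   presenting the group < sigma1, sigma2 | sigma1 sigma2 sigma1 =
   sigma2 sigma1 sigma2 >. *)
Inductive braid_eq : word -> word -> Prop :=
| braid_eq_refl u : braid_eq u u
| braid_eq_sym u v : braid_eq u v -> braid_eq v u
| braid_eq_trans u v w : braid_eq u v -> braid_eq v w -> braid_eq u w
| braid_eq_cat u u' v v' :
    braid_eq u u' -> braid_eq v v' -> braid_eq (u ++ v) (u' ++ v')
| braid_eq_cancel a : braid_eq [:: a; inv_letter a] [::]
| braid_eq_artin :
    braid_eq [:: sigma1; sigma2; sigma1] [:: sigma2; sigma1; sigma2].

Definition braid_conj (u v : word) : Prop :=
  exists w : word, braid_eq v (inv_word w ++ u ++ w).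

Definition min_length_in_conj_class (beta : word) : Prop :=
  forall gamma : word, braid_conj beta gamma -> size beta <= size gamma.

(* The edge (s, t) of the closure of beta is the part of the diagram at
   position s = 0, 1, 2 (from left to right) immediately below the t-th letter,
   the braid running upwards; above the last letter it is closed up to level 0.
   In a positive letter the strand from bottom left to top right is over. *)
Section Closure.
Variable beta : word.
Let level := 'I_(size beta).
Let left_pos (i : 'I_2) : 'I_3 := widen_ord (leqnSn 2) i.
Let right_pos (i : 'I_2) : 'I_3 := lift ord0 i.

Definition closure_xing (t : level) : xing ('I_3 * level)%type :=
  let: (i, positive) := tnth (in_tuple beta) t in
  let bl := (left_pos i, t) in
  let br := (right_pos i, t) in
  let tl := (left_pos i, ordS t) in
  let tr := (right_pos i, ordS t) in
  if positive then Xing br tr tl bl else Xing bl br tr tl.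

Definition closure_joins (t : level) :
    seq (('I_3 * level) * ('I_3 * level))%type :=
  let i := (tnth (in_tuple beta) t).1 in
  [seq ((s, t), (s, ordS t)) | s <- enum 'I_3
                             & (s != left_pos i) && (s != right_pos i)].

Definition braid_closure : diagram :=
  @Diagram ('I_3 * level)%type
    [seq closure_xing t | t <- enum 'I_(size beta)]
    (flatten [seq closure_joins t | t <- enum 'I_(size beta)]).
End Closure.

Local Open Scope ring_scope.

(* The product of the sigma_(p_j)^(q_j), with p_j alternating from p_1 = p. *)
Fixpoint syllable_word (p : 'I_2) (q : seq int) : word :=
  if q is x :: q' then nseq `|x|%N (p, 0 < x) ++ syllable_word (ordS p) q'
  else [::].

(* The p_j alternate cyclically because the length of q is even.  Words and
   Schreier vectors are both taken up to cyclic permutation, so a word such as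
   sigma1 sigma2 sigma1 has the Schreier vector (2, 1). *)
Definition schreier_vector (beta : word) (q : seq int) : Prop :=
  [/\ 0 \notin q, ~~ odd (size q)
    & exists (p : 'I_2) (m : nat), rot m beta = syllable_word p q].

Definition positive_vector (q : seq int) : bool := all (fun x => 0 < x) q.

Definition positive_entries_isolated (q : seq int) : Prop :=
  forall j : 'I_(size q),
    0 < q`_j -> q`_(ord_pred j) < 0 /\ q`_(ordS j) < 0.

Definition cyclic_subword (u w : word) : bool :=
  [exists m : 'I_(size w), prefix u (rot m w)].

Definition word121_inv : word :=
  [:: inv_letter sigma1; inv_letter sigma2; inv_letter sigma1].
Definition word212_inv : word :=
  [:: inv_letter sigma2; inv_letter sigma1; inv_letter sigma2].

(* Main.v *)
Require Import Defs.
From mathcomp Require Import all_boot all_order all_algebra.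
From mathcomp Require Import zify ring.

Set Implicit Arguments.
Unset Strict Implicit.
Unset Printing Implicit Defensive.

Import Order.TTheory GRing.Theory Num.Theory.

(** All three conditions on [beta] are compared with one condition on cyclic
    words, [efficient]: either all letters are positive, or the word contains no
    inverse of [Delta] and each positive letter has as cyclic neighbours only
    letters of its own type, where [sigma1^-1, sigma2] form one type and
    [sigma1, sigma2^-1] the other.  Each of the three conditions turns out to
    say that [beta] or its mirror image is efficient.

    For (c) this is a translation from Schreier vectors to words
    ([efficient_vectorP]).

    If neither [beta] nor its mirror image is efficient, the cyclic word can be
    shortened ([min_length_efficient]).  It has letters of both signs.  If it
    contains [Delta] or its inverse, that factor slides to the nearest letter of
    the other sign and cancels against it.  Otherwise two adjacent positive
    letters with different generators and two adjacent negative ones occur, and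
    the relation [a b^k a^-1 = b^-1 a^k b] moves the first pair towards the
    second until two letters cancel.

    Conversely an efficient word [w] is of minimal length
    ([efficient_min_length]).  The exponent sum is a conjugacy invariant, so it
    is enough to bound below the number of positive letters, or equivalently the
    cost, in which a negative letter counts once and a positive one twice.
    Modulo its centre, B_3 is the free product of Z/2, generated by the image
    [S] of [Delta], and Z/3, generated by the image [T] of
    [sigma1 sigma2]; the generators become [T^2 S] and [S T^2], their
    inverses [S T] and [T S].  In a calm word the only reductions are
    [T S S T = T^2], which keep the cost if [T] costs 1 and [T^2] costs 2, so
    the cost can be read off the conjugacy class.  Instead of normal forms in
    the free product, the proof uses a representation by integer polynomial
    matrices of size 3 in which [T] has degree 1 and [T^2] degree 2.  Then the
    degree of the trace is at most the cost of the word, and for calm words that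
    contain a positive letter it is equal to the cost because the leading
    matrices map a cone of row vectors into itself ([trace_lead_gt0]).

    Finally the A-state of a closed braid keeps the strands at a positive letter
    and replaces a negative letter by a cap below a cup, while its B-state is
      the
    A-state of the mirror image.  Adequacy is compared with efficiency in
    [no_self_loop_efficient].  If a negative letter occurs, then at each level
    two adjacent strands lie in the same loop;
      this rules out positive neighbours
    with different generators, and a negative letter between two negative
      letters
    of the other generator has its two sides joined through them.  In the other
    direction, the levels that lie between letters of the same type carry small
    loops, which are closed off from the remaining strand. *)

(** * Cyclic words *)

Definition is_neg (a : letter) : bool := ~~ a.2.

(** A word all of whose letters have one type is a word in [sigma1^-1, sigma2]
    or in [sigma1, sigma2^-1], so its closure is an alternating diagram. *)
Definition letter_type (a : letter) : bool := (a.1 == ord_max) (+) a.2.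

(** For letters that are not inverse to each other, this only excludes two
    positive letters with different generators. *)
Definition calm (a b : letter) : bool :=
  (letter_type a == letter_type b) || is_neg a && is_neg b.

Definition alternating_neg (a b c : letter) : bool :=
  [&& is_neg a, is_neg b, is_neg c, a.1 != b.1 & b.1 != c.1].

Definition calm_word (w : word) : bool :=
  [&& cycle calm w, ~~ cyclic_subword word121_inv w
    & ~~ cyclic_subword word212_inv w].

Lemma gen_cases (i : 'I_2) : i = ord0 \/ i = ord_max.
Proof. by case: i => [[|[|//]] H]; [left|right]; apply: val_inj. Qed.

Lemma letter_cases (a : letter) :
  [\/ a = sigma1, a = sigma2, a = inv_letter sigma1 | a = inv_letter sigma2].
Proof.
case: a => i [] ; case: (gen_cases i) => ->.
- exact: Or41. - exact: Or42. - exact: Or43. - exact: Or44.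
Qed.

Lemma inv_letterK : involutive inv_letter.
Proof. by case=> i b; rewrite /inv_letter /= negbK. Qed.

Lemma mirrorK : involutive mirror.
Proof. exact: mapK inv_letterK. Qed.

Lemma cyclic_subwordP (a : letter) (u w : word) :
  reflect (exists m s, rot m w = (a :: u) ++ s) (cyclic_subword (a :: u) w).
Proof.
apply: (iffP existsP) => [[m /prefixP [s E]] | [m [s E]]].
  by exists m, s.
have w_gt0 : 0 < size w by rewrite -(size_rot m) E.
have [m_lt | m_ge] := ltnP m (size w).
  by exists (Ordinal m_lt); rewrite /= E prefix_prefix.
by exists (Ordinal w_gt0); rewrite /= rot0 -(rot_oversize m_ge) E prefix_prefix.
Qed.

Lemma cyclic_subword_rot (a : letter) (u w : word) (n : nat) :
  cyclic_subword (a :: u) (rot n w) = cyclic_subword (a :: u) w.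
Proof.
apply/cyclic_subwordP/cyclic_subwordP => [[m [s E]] | [m [s E]]].
  by exists (rot_add w n m), s; rewrite -rot_rot_add.
by exists (rot_add (rot n w) (size w - n) m), s;
  rewrite -rot_rot_add -{1}(size_rot n) -[rot (_ - _) _]/(rotr n (rot n w))
    rotK.
Qed.

Lemma calm_word_rot (n : nat) (w : word) :
  calm_word (rot n w) = calm_word w.
Proof.
by rewrite /calm_word rot_cycle !cyclic_subword_rot.
Qed.

(** * Conjugacy of words *)

Lemma braid_eq_catl (u v v' : word) :
  braid_eq v v' -> braid_eq (u ++ v) (u ++ v').
Proof. exact: braid_eq_cat (braid_eq_refl u). Qed.

Lemma braid_eq_catr (v u u' : word) :
  braid_eq u u' -> braid_eq (u ++ v) (u' ++ v).
Proof. by move=> E; apply: braid_eq_cat E (braid_eq_refl v). Qed.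

Lemma inv_word_cat (u v : word) : inv_word (u ++ v) = inv_word v ++ inv_word u.
Proof. by rewrite /inv_word map_cat rev_cat. Qed.

Lemma inv_wordK : involutive inv_word.
Proof. by move=> u; rewrite /inv_word map_rev revK (mapK inv_letterK). Qed.

Lemma braid_eq_mulV (u : word) : braid_eq (u ++ inv_word u) [::].
Proof.
elim: u => [|a u IHu]; first exact: braid_eq_refl.
rewrite -[a :: u]cat1s inv_word_cat -catA (catA u).
apply: braid_eq_trans (braid_eq_cancel a).
exact: braid_eq_catl (braid_eq_catr _ IHu).
Qed.

Lemma braid_eq_Vmul (u : word) : braid_eq (inv_word u ++ u) [::].
Proof. by rewrite -{2}(inv_wordK u); apply: braid_eq_mulV. Qed.

Lemma braid_conj_rot (n : nat) (w : word) : braid_conj w (rot n w).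
Proof.
exists (take n w); rewrite -[X in X ++ take n w](cat_take_drop n w) -catA catA.
exact/braid_eq_sym/(braid_eq_catr _ (braid_eq_Vmul _)).
Qed.

Lemma braid_conj_eq (u v v' : word) :
  braid_conj u v -> braid_eq v v' -> braid_conj u v'.
Proof.
by move=> [w E] E'; exists w; apply: braid_eq_trans (braid_eq_sym E') E.
Qed.

Lemma braid_eq_mirror (u v : word) :
  braid_eq u v -> braid_eq (mirror u) (mirror v).
Proof.
elim=> {u v} [u|u v _|u v w _ E1 _ E2|u u' v v' _ E1 _ E2|a|].
- exact: braid_eq_refl.
- exact: braid_eq_sym.
- exact: braid_eq_trans E1 E2.
- by rewrite /mirror !map_cat; apply: braid_eq_cat.
- exact: braid_eq_cancel.
(* The inverses of the two sides of Artin's relation. *)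
pose u := [:: sigma1; sigma2; sigma1]; pose v := [:: sigma2; sigma1; sigma2].
apply: (@braid_eq_trans _ (inv_word u ++ v ++ inv_word v)).
  rewrite -[mirror _]/(inv_word u) -{1}[inv_word u]cats0.
  exact/braid_eq_catl/braid_eq_sym/braid_eq_mulV.
rewrite -[mirror _]/(inv_word v) catA; apply: (@braid_eq_catr _ _ [::]).
apply: braid_eq_trans (braid_eq_Vmul u).
exact/braid_eq_catl/braid_eq_sym/braid_eq_artin.
Qed.

Lemma mirror_cat (u v : word) : mirror (u ++ v) = mirror u ++ mirror v.
Proof. exact: map_cat. Qed.

Lemma mirror_inv_word (u : word) : mirror (inv_word u) = inv_word (mirror u).
Proof. by rewrite /mirror /inv_word map_rev. Qed.

Lemma min_length_mirror (w : word) :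
  min_length_in_conj_class w -> min_length_in_conj_class (mirror w).
Proof.
move=> w_min v [g /braid_eq_mirror].
rewrite !mirror_cat mirrorK mirror_inv_word size_map.
rewrite -[size v](size_map inv_letter) => E.
by apply: w_min; exists (mirror g).
Qed.

(** * Shortening a word *)

Definition shortens (u : word) : Prop :=
  exists2 v, braid_eq u v & size v < size u.

Lemma shortens_eq (u v : word) :
  braid_eq u v -> size u = size v -> shortens v -> shortens u.
Proof.
by move=> E Es [v' E' lt]; exists v'; [apply: braid_eq_trans E E'|rewrite Es].
Qed.

Lemma shortens_cat (s u t : word) : shortens u -> shortens (s ++ u ++ t).
Proof.
move=> [v E lt]; exists (s ++ v ++ t).
  exact/braid_eq_catl/braid_eq_catr.
by rewrite !size_cat ltn_add2l ltn_add2r.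
Qed.

Lemma min_length_not_shortens (w : word) (n : nat) :
  min_length_in_conj_class w -> ~ shortens (rot n w).
Proof.
move=> w_min [v E]; rewrite size_rot ltnNge w_min //.
exact: braid_conj_eq (braid_conj_rot n w) E.
Qed.

Lemma shortens_cancel (a : letter) : shortens [:: a; inv_letter a].
Proof. by exists [::]; first exact: braid_eq_cancel. Qed.

Lemma braid_eq_artin_gen (i j : 'I_2) : i != j ->
  braid_eq [:: (i, true); (j, true); (i, true)]
           [:: (j, true); (i, true); (j, true)].
Proof.
case: (gen_cases i) => ->; case: (gen_cases j) => -> // _.
  exact: braid_eq_artin.
exact/braid_eq_sym/braid_eq_artin.
Qed.

Lemma braid_eq_cancel_mid (s t : word) (a : letter) :
  braid_eq (s ++ [:: a, inv_letter a & t]) (s ++ t).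
Proof. exact: braid_eq_catl (braid_eq_catr t (braid_eq_cancel a)). Qed.

(** From [b a b^k = a^k b a], which iterates Artin's relation. *)
Lemma braid_eq_slide (i j : 'I_2) (k : nat) : i != j ->
  braid_eq ((i, true) :: nseq k (j, true) ++ [:: (i, false)])
           ((j, false) :: nseq k (i, true) ++ [:: (j, true)]).
Proof.
move=> ij; set a := (i, true); set b := (j, true).
have E : braid_eq ([:: b; a] ++ nseq k b) (nseq k a ++ [:: b; a]).
  elim: k => [|k IHk]; first exact: braid_eq_refl.
  apply: (@braid_eq_trans _ ([:: a; b; a] ++ nseq k b)).
    apply: (@braid_eq_catr (nseq k b) [:: b; a; b]).
    by apply: braid_eq_artin_gen; rewrite eq_sym.
  exact: (@braid_eq_catl [:: a]).
apply: (@braid_eq_trans _ ((j, false) :: [:: b;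
  a] ++ nseq k b ++ [:: (i, false)])).
  exact: (braid_eq_sym (@braid_eq_cancel_mid [::] _ (j, false))).
apply: (@braid_eq_catl [:: (j, false)]).
apply: (@braid_eq_trans _ ((nseq k a ++ [:: b; a]) ++ [:: (i, false)])).
  by rewrite catA; apply: braid_eq_catr.
rewrite -catA; apply: braid_eq_catl.
exact: (@braid_eq_cancel_mid [:: b] [::] a).
Qed.

(** The positive pair moves to the right: it absorbs or drops positive letters,
    cancels against the inverse of its last letter, and slides past the inverse
    of its first letter.  In the end it cancels against the negative pair. *)
Lemma shortens_pos_neg (i j c d : 'I_2) (k : nat) (s : word) :
  i != j -> c != d ->
  shortens ((i, true) :: nseq k.+1 (j, true) ++ s ++ [:: (c, false);
    (d, false)]).
Proof.
move=> + cd; move: s i j k.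
have nseqSr n (x : letter) : nseq n.+1 x = nseq n x ++ [:: x].
  by rewrite -addn1 nseqD.
have gen_eq (l i j : 'I_2) : i != j -> l != j -> l = i.
  by case: (gen_cases l) (gen_cases i) (gen_cases j) => -> [] -> [] ->.
elim=> [|[l b] s IHs] i j k ij.
  (* Both pairs meet: either [c = j], or [c = i] and [d = j]. *)
  have [<-|cj] := eqVneq c j.
    rewrite nseqSr -catA.
    exact: (@shortens_cat (_ :: _) _ [:: _] (shortens_cancel (c, true))).
  have ci := gen_eq _ _ _ ij cj; have dj : d = j.
    by apply: (gen_eq d j i); rewrite 1?eq_sym // -ci.
  rewrite ci dj.
  apply: (@shortens_eq _ (((j, false) :: nseq k.+1 (i, true))
                          ++ [:: (j, true); (j, false)] ++ [::])).
  - have := braid_eq_catr [:: (j, false)] (braid_eq_slide k.+1 ij).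
    by rewrite /= -!catA.
  - by rewrite /= !size_cat !size_nseq.
  exact: shortens_cat (shortens_cancel (j, true)).
have [-> | /(gen_eq _ _ _ ij) ->] := eqVneq l j; case: b.
- by have := IHs i j k.+1 ij; rewrite (nseqSr k.+1) -catA.
- rewrite nseqSr -catA.
  exact: (@shortens_cat (_ :: _) _ _ (shortens_cancel (j, true))).
- rewrite nseqSr -catA.
  have := IHs j i 0; rewrite eq_sym => /(_ ij).
  by move/(@shortens_cat ((i, true) :: nseq k (j, true)) _ [::]); rewrite cats0.
pose t := s ++ [:: (c, false); (d, false)].
apply: (@shortens_eq _ (((j, false) :: nseq k (i, true))
                        ++ (i, true) :: (j, true) :: t)).
- have := braid_eq_catr t (braid_eq_slide k.+1 ij).
  by rewrite (nseqSr k (i, true)) /= -!catA.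
- by rewrite /= !size_cat /= !size_cat !size_nseq /=; lia.
have := IHs i j 0 ij.
by move/(@shortens_cat ((j, false) :: nseq k (i, true)) _ [::]); rewrite cats0.
Qed.

Definition swap_letter (a : letter) : letter := (ordS a.1, a.2).

Definition delta (i : 'I_2) : word := [:: (i, true); (ordS i, true); (i, true)].

Lemma ordS2_neq (i : 'I_2) : i != ordS i.
Proof. by case: (gen_cases i) => ->. Qed.

Lemma ordS2K (i : 'I_2) : ordS (ordS i) = i.
Proof. by case: (gen_cases i) => ->; apply: val_inj. Qed.

Lemma ordS2_eq (i j : 'I_2) : i != j -> j = ordS i.
Proof.
by case: (gen_cases i) => ->; case: (gen_cases j) => -> // _; apply: val_inj.
Qed.

Lemma delta_swap (i j : 'I_2) : braid_eq (delta i) (delta j).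
Proof.
have [<-|/ordS2_eq ->] := eqVneq i j; first exact: braid_eq_refl.
by rewrite /delta ordS2K; apply: braid_eq_artin_gen (ordS2_neq i).
Qed.

Lemma delta_slide (i : 'I_2) (s : word) : all (fun a => a.2) s ->
  braid_eq (delta i ++ s) (map swap_letter s ++ delta i).
Proof.
elim: s => [|[j [] //] s IHs]; first by move=> _; apply: braid_eq_refl.
move=> s_pos; have {}IHs := IHs s_pos.
apply: (@braid_eq_trans _ ([:: (ordS j, true)] ++ delta i ++ s)); last first.
  exact: braid_eq_catl IHs.
rewrite catA -[(j, true) :: s]cat1s catA; apply: braid_eq_catr.
apply: (@braid_eq_trans _ (delta (ordS j) ++ [:: (j, true)])).
  exact: braid_eq_catr (delta_swap _ _).
rewrite /delta ordS2K /= -[[:: _, _, _ & _]]/([:: (ordS j, true)] ++ delta j).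
exact: braid_eq_catl (delta_swap _ _).
Qed.

(** [Delta] slides through the positive letters up to a negative letter, which
    cancels against one of the three letters of [Delta]. *)
Lemma shortens_delta (i : 'I_2) (s : word) :
  has is_neg s -> shortens (delta i ++ s).
Proof.
case/split_find => -[j [] //] s1 s2 _ s1_pos.
have {}s1_pos : all (fun a => a.2) s1.
  by rewrite -[all _ _]negbK -has_predC s1_pos.
exists (map swap_letter s1 ++ [:: (j, true); (ordS j, true)] ++ s2); last first.
  by rewrite !size_cat size_rcons size_map /=; lia.
rewrite cat_rcons catA.
apply: (@braid_eq_trans _ ((map swap_letter s1 ++ delta i) ++ (j, false) ::
  s2)).
  exact: braid_eq_catr (delta_slide i s1_pos).
rewrite -catA; apply: braid_eq_catl.
apply: (@braid_eq_trans _ (delta j ++ (j, false) :: s2)).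
  exact: braid_eq_catr (delta_swap _ _).
exact: (@braid_eq_cancel_mid [:: (j, true); (ordS j, true)] s2 (j, true)).
Qed.

Lemma not_path_split (T : Type) (e : rel T) (x : T) (p : seq T) :
  ~~ path e x p ->
  exists p1 a b p2, x :: p = p1 ++ [:: a, b & p2] /\ ~~ e a b.
Proof.
elim: p x => //= y p IHp x; rewrite negb_and => /orP [nxy | /IHp].
  by exists [::], x, y, p.
by move=> [p1 [a [b [p2 [-> nab]]]]]; exists (x :: p1), a, b, p2.
Qed.

Lemma not_cycle_rot (T : Type) (e : rel T) (w : seq T) :
  reflexive e -> ~~ cycle e w ->
  exists m a b s, rot m w = [:: a, b & s] /\ ~~ e a b.
Proof.
move=> e_refl; case: w => // x s nw;
  have [p1 [a [b [p2 [E nab]]]]] := not_path_split nw.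
case/lastP: p2 E => [|p2 y].
  rewrite -rcons_cons -[[:: a; b]]/(rcons [:: a] b) -rcons_cat.
  move/rcons_inj => [E xb]; case: p1 E => [[xa _]|z p1 [_ sE]].
    by move: nab; rewrite -xa -xb e_refl.
  exists (size (x :: p1)), a, b, p1; split=> //.
  by rewrite sE -[x :: _ ++ _]/((x :: p1) ++ [:: a]) rot_size_cat -xb.
rewrite -rcons_cons -2!rcons_cons -rcons_cat => /rcons_inj [E _].
exists (size p1), a, b, (p2 ++ p1); split=> //.
by rewrite E rot_size_cat.
Qed.

Lemma calm_refl : reflexive calm.
Proof. by move=> a; rewrite /calm eqxx. Qed.

Lemma not_calm (a b : letter) :
  ~~ calm a b -> b = inv_letter a \/ [/\ a.2, b.2 & a.1 != b.1].
Proof.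
case: (letter_cases a) => ->; case: (letter_cases b) => -> //=;
  by [left | right].
Qed.

(** An inverse of [Delta] cancels against a positive letter, and two adjacent
    inverse letters cancel, so in a word of minimal length only one obstruction
    to being calm is left. *)
Lemma min_length_not_calm (w : word) :
  min_length_in_conj_class w -> has (fun a => a.2) w -> ~~ calm_word w ->
  exists m i j s, rot m w = [:: (i, true), (j, true) & s] /\ i != j.
Proof.
move=> w_min w_pos; rewrite /calm_word !negb_and !negbK.
case/orP => [/(not_cycle_rot calm_refl) [m [a [b [s [E nab]]]]] | inv_delta].
  case: (not_calm nab) => [ba | [a_pos b_pos ab]].
    case: (min_length_not_shortens (n := m) w_min).
    by rewrite E ba; apply: (@shortens_cat [::] [:: _;
      _] s (shortens_cancel a)).
  case: a b a_pos b_pos ab E {nab} => [i []] [j []] // _ _ ij E.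
  by exists m, i, j, s.
have [i [m [s E]]] : exists i m s, rot m (mirror w) = delta i ++ s.
  have e0 : mirror word121_inv = delta ord0 by rewrite /delta -(ordS2_eq (j :=
    ord_max)).
  have e1 : mirror word212_inv =
    delta ord_max by rewrite /delta -(ordS2_eq (j := ord0)).
  case/orP: inv_delta => /cyclic_subwordP [m [s E]].
    by exists ord0, m, (mirror s); rewrite /mirror -map_rot E map_cat -e0.
  by exists ord_max, m, (mirror s); rewrite /mirror -map_rot E map_cat -e1.
case: (min_length_not_shortens (n := m) (min_length_mirror w_min)).
rewrite E; apply: shortens_delta.
have : has is_neg (delta i ++ s).
  rewrite -E has_rot has_map; apply: etrans w_pos.
  by apply: eq_has => a; apply: negbK.
by rewrite has_cat.
Qed.

Definition efficient (w : word) : bool := all (fun a => a.2) w || calm_word w.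

Lemma min_length_efficient (w : word) :
  min_length_in_conj_class w -> efficient w || efficient (mirror w).
Proof.
move=> w_min; apply/contraT; rewrite !negb_or -!andbA.
case/and4P => w_neg w_ncalm mw_neg mw_ncalm.
have w_pos : has (fun a => a.2) w.
  apply: contraNT mw_neg => /hasPn w_neg'.
  by apply/allP => _ /mapP [a /w_neg' a_neg ->].
have mw_pos : has (fun a => a.2) (mirror w).
  by rewrite has_map; rewrite -has_predC in w_neg.
have [m [i [j [s [E ij]]]]] := min_length_not_calm w_min w_pos w_ncalm.
have [n [c [d [t [E' cd]]]]] :=
  min_length_not_calm (min_length_mirror w_min) mw_pos mw_ncalm.
pose e (a b : letter) := ~~ [&& is_neg a, is_neg b & a.1 != b.1].
have : ~~ cycle e (rot m w).
  rewrite rot_cycle -(rot_cycle n) -(mirrorK w) /mirror -map_rot E' /=.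
  by rewrite /e /= cd.
rewrite E => w_e; have [p1 [a [b [p2 [Ep]]]]] := not_path_split w_e.
rewrite negbK => /and3P [a_neg b_neg ab].
case: p1 Ep => [[ai _ _]|x [[_ ai _]|y p1 [_ _]]];
  try by rewrite -ai in a_neg.
case/lastP: p2 => [|p2 z].
  rewrite -[[:: a; b]]/(rcons [:: a] b) -rcons_cat => /rcons_inj [_ bi].
  by rewrite -bi in b_neg.
rewrite -2!rcons_cons -rcons_cat => /rcons_inj [Es _].
case: (min_length_not_shortens (n := m) w_min); rewrite E Es.
case: a b a_neg b_neg ab {Es} => [a []] [b []] //= _ _ ab.
have := shortens_pos_neg 0 p1 ij ab.
by move/(@shortens_cat [::] _ p2); rewrite /= -!catA.
Qed.

(** * Schreier vectors *)

Lemma nth_codom_ord (T : Type) (n : nat) (f : 'I_n -> T) (x0 : T) (t : 'I_n) :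
  nth x0 [seq f i | i <- enum 'I_n] t = f t.
Proof. by rewrite (nth_map t) ?size_enum_ord // nth_ord_enum. Qed.

Lemma cycle_codomP (T : Type) (e : rel T) (n : nat) (f : 'I_n -> T) :
  reflect (forall t, e (f t) (f (ordS t))) (cycle e [seq f t | t <- enum 'I_n]).
Proof.
case: n f => [|n] f; first by rewrite enum_ord0; left; case.
set s := [seq _ | _ <- _]; have s_size : size s = n.+1.
  by rewrite size_map size_enum_ord.
have nth_s (t : 'I_n.+1) : nth (f ord0) s t = f t by exact: nth_codom_ord.
have nth_rs (t : 'I_n.+1) : nth (f ord0) (rcons s (f ord0)) t = f t.
  by rewrite nth_rcons s_size ltn_ord nth_s.
have nth_rsS (t : 'I_n.+1) : nth (f ord0) (rcons s (f ord0)) t.+1 = f (ordS t).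
  rewrite nth_rcons s_size; case: ltnP => [t_lt | t_ge].
    by rewrite -(nth_s (ordS t)) /= modn_small.
  have tn : t.+1 = n.+1 by apply/eqP; rewrite eqn_leq t_ge ltn_ord.
  by rewrite tn eqxx; congr f; apply: val_inj; rewrite /= tn modnn.
clearbody s; case: s s_size nth_s nth_rs nth_rsS => // x s s_size nth_s.
rewrite rcons_cons /= => nth_rs nth_rsS.
have {nth_s} xE : x = f ord0 by rewrite -(nth_s ord0).
case: s_size => s_size; subst x.
apply: (iffP (pathP (f ord0))); rewrite size_rcons s_size => E.
  by move=> t; rewrite -nth_rs -nth_rsS; apply: E.
by move=> i i_lt; rewrite (nth_rs (Ordinal i_lt)) (nth_rsS (Ordinal i_lt)).
Qed.

(** One letter for each syllable: a relation that holds between equal letters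
    can be tested on these. *)
Fixpoint syllable_heads (p : 'I_2) (q : seq int) : word :=
  if q is x :: q' then (p, (0 < x)%R) :: syllable_heads (ordS p) q' else [::].

Lemma syllable_headsE (p : 'I_2) (q : seq int) :
  syllable_heads p q =
  [seq (iter j (@ordS 2) p, (0 < q`_j)%R)
  | j : 'I_(size q) <- enum 'I_(size q)].
Proof.
elim: q p => [|x q IHq] p /=; first by rewrite enum_ord0.
rewrite enum_ordSl /= IHq -map_comp; congr cons; apply: eq_map => j /=.
by rewrite -iterS iterSr.
Qed.

Lemma path_syllables (e : rel letter) (p : 'I_2) (q : seq int) (x : letter) t :
  reflexive e -> 0%R \notin q ->
  path e x (syllable_word p q ++ t) = path e x (syllable_heads p q ++ t).
Proof.
move=> e_refl; elim: q p x => //= a q IHq p x.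
rewrite inE negb_or eq_sym -absz_gt0 => /andP [a_n0 /IHq {}IHq].
case: `|a|%N a_n0 => //= n _; congr andb; rewrite -IHq.
by elim: n => //= n IHn; rewrite e_refl.
Qed.

Lemma cycle_syllables (e : rel letter) (p : 'I_2) (q : seq int) :
  reflexive e -> 0%R \notin q ->
  cycle e (syllable_word p q) = cycle e (syllable_heads p q).
Proof.
move=> e_refl; case: q => //= a q.
rewrite inE negb_or eq_sym -absz_gt0 => /andP [a_n0 q_n0].
case: `|a|%N a_n0 => //= n _; rewrite -!cats1 -path_syllables // -catA.
by elim: n => //= n IHn; rewrite e_refl.
Qed.

Lemma calm_alternate (i j : 'I_2) (b c : bool) :
  i != j -> calm (i, b) (j, c) = ~~ (b && c).
Proof.
by case: (gen_cases i) => ->; case: (gen_cases j) => ->; case: b; case: c.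
Qed.

Lemma iter_ordS2_cycle (n j : nat) (p : 'I_2) : ~~ odd n -> j < n ->
  iter (j.+1 %% n) (@ordS 2) p = ordS (iter j (@ordS 2) p).
Proof.
move=> n_even j_lt; have [j1_lt|j1_ge] := ltnP j.+1 n;
  first by rewrite modn_small.
have jn : j.+1 = n by apply/eqP; rewrite eqn_leq j1_ge j_lt.
rewrite -iterS jn modnn /=; rewrite -(odd_double_half n) (negPf n_even) add0n.
by elim: n./2 => // m IHm; rewrite doubleS !iterS -IHm ordS2K.
Qed.

Lemma cycle_calm_isolated (w : word) (q : seq int) : schreier_vector w q ->
  cycle calm w <-> positive_entries_isolated q.
Proof.
case=> q_n0 q_even [p [m E]]; rewrite -(rot_cycle m) E.
rewrite cycle_syllables //; last exact: calm_refl.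
rewrite syllable_headsE.
have calmE (j : 'I_(size q)) :
    calm (iter j (@ordS 2) p, (0 < q`_j)%R)
         (iter (ordS j) (@ordS 2) p, (0 < q`_(ordS j))%R)
    = ~~ ((0 < q`_j)%R && (0 < q`_(ordS j))%R).
  by rewrite calm_alternate // iter_ordS2_cycle ?ltn_ord // ordS2_neq.
have neg (j : 'I_(size q)) : ~~ (0 < q`_j)%R -> (q`_j < 0)%R.
  rewrite -leNgt le_eqVlt => /orP [/eqP qj0|//].
  by case/negP: q_n0; rewrite -qj0 mem_nth.
split=> [/cycle_codomP C j qj | I].
  have := C j; rewrite calmE qj => /neg ->.
  by have := C (ord_pred j); rewrite calmE ord_predK qj andbT => /neg ->.
apply/cycle_codomP => j; rewrite calmE; apply/negP => /andP [qj qSj].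
by have [_] := I j qj; rewrite ltNge ltW.
Qed.

Lemma all_syllables (p : 'I_2) (q : seq int) : 0%R \notin q ->
  all (fun a => a.2) (syllable_word p q) = positive_vector q.
Proof.
rewrite /positive_vector; elim: q p => //= a q IHq p.
rewrite inE negb_or eq_sym -absz_gt0 => /andP [a_n0 /IHq {}IHq].
by rewrite all_cat all_nseq eqn0Ngt a_n0 IHq.
Qed.

Lemma all_positive_vector (w : word) (q : seq int) : schreier_vector w q ->
  all (fun a => a.2) w = positive_vector q.
Proof.
case=> q_n0 _ [p [m E]].
by rewrite -(all_syllables p q_n0) -E; apply/esym/eq_all_r/mem_rot.
Qed.

Lemma schreier_vector_mirror (w : word) (q : seq int) :
  schreier_vector w q -> schreier_vector (mirror w) (map (@GRing.opp int) q).
Proof.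
case=> q_n0 q_even [p [m E]]; split; last first.
- exists p, m; rewrite /mirror -map_rot E.
  elim: q p q_n0 {E q_even} => //= a q IHq p.
  rewrite inE negb_or => /andP [a_n0 /IHq <-].
  rewrite map_cat map_nseq abszN /inv_letter /=; congr (nseq _ (p, _) ++ _).
  by rewrite oppr_gt0 -leNgt le_eqVlt eq_sym (negPf a_n0).
- by rewrite size_map.
by rewrite -oppr0 (mem_map (@oppr_inj _)).
Qed.

Lemma efficient_vectorP (beta : word) (q : seq int) : schreier_vector beta q ->
  (exists (gamma : word) (r : seq int),
      [/\ gamma = beta \/ gamma = mirror beta, schreier_vector gamma r
        & positive_vector r
          \/ [/\ ~~ cyclic_subword word121_inv gamma,
                 ~~ cyclic_subword word212_inv gamma
               & positive_entries_isolated r]])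
  <-> efficient beta || efficient (mirror beta).
Proof.
move=> beta_q.
have E gamma r : schreier_vector gamma r ->
    efficient gamma <->
    positive_vector r \/ [/\ ~~ cyclic_subword word121_inv gamma,
       ~~ cyclic_subword word212_inv gamma & positive_entries_isolated r].
  move=> gamma_r; have I := cycle_calm_isolated gamma_r.
  rewrite /efficient (all_positive_vector gamma_r) /calm_word.
  split=> [/orP [|/and3P [/I]]|[->//|[-> -> /I ->]]]; first by left.
    by right.
  by rewrite orbT.
split=> [[gamma [r [gammaE gamma_r /(E _ _ gamma_r) C]]] | /orP [C | C]].
- by case: gammaE C => <- ->; rewrite ?orbT.
- by exists beta, q; split; [left | | apply/E].
exists (mirror beta), (map (@GRing.opp int) q);
  have r := schreier_vector_mirror beta_q.
by split; [right | | apply/E].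
Qed.

(** Among any two consecutive entries of the Schreier vector one is negative,
    and there are at least four entries.  Were there only one negative letter,
    the loops next to it would close up around the braid axis. *)
Lemma cycle_calm_count_neg (w : word) (q : seq int) :
  schreier_vector w q -> 2 < size q -> cycle calm w -> 1 < count is_neg w.
Proof.
case=> q_n0 q_even [p [m E]] q_gt2.
have /permP -> : perm_eq w (rot m w) by rewrite perm_sym perm_rot.
rewrite -(rot_cycle m) E cycle_syllables //; last exact: calm_refl.
case: q q_n0 q_even q_gt2 {E} => [|a [|b [|c [|d q]]]] //=.
rewrite !inE !negb_or ![0%R == _]eq_sym => /and5P [a0 b0 c0 d0 _] _ _.
rewrite !calm_alternate ?ordS2_neq // => /and4P [ab _ cd _].
rewrite !count_cat !count_nseq /is_neg /=.
move: a0 b0 c0 d0; rewrite -!absz_gt0.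
by case: (0 < a)%R (0 < b)%R (0 < c)%R (0 < d)%R ab cd => [] [] [] [] //=; lia.
Qed.

Lemma schreier_reduced (w : word) (q : seq int) : schreier_vector w q ->
  cycle (fun a b => b != inv_letter a) w.
Proof.
case=> q_n0 q_even [p [m E]]; rewrite -(rot_cycle m) E.
rewrite cycle_syllables //; last by move=> [i []];
  rewrite /inv_letter xpair_eqE andbF.
rewrite syllable_headsE; apply/cycle_codomP => j.
rewrite /inv_letter xpair_eqE iter_ordS2_cycle // negb_and eq_sym.
by rewrite ordS2_neq.
Qed.

(** * The loops of a state *)

Definition left_strand (i : 'I_2) : 'I_3 := widen_ord (leqnSn 2) i.
Definition right_strand (i : 'I_2) : 'I_3 := lift ord0 i.

Definition touch (i : 'I_2) (s : 'I_3) : bool :=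
  (s == left_strand i) || (s == right_strand i).

Lemma left_touch (i : 'I_2) : touch i (left_strand i).
Proof. by rewrite /touch eqxx. Qed.

Lemma right_touch (i : 'I_2) : touch i (right_strand i).
Proof. by rewrite /touch eqxx orbT. Qed.

(** What the loops of a state look like when positive letters keep the strands
    and negative letters become a cap and a cup.  The last field says that
    [conn] is the least equivalence relation with the other properties. *)
Record loops_of (n : nat) (l : 'I_n -> letter) (conn : rel ('I_3 * 'I_n)) :
  Prop :=
  LoopsOf {
    loops_equiv : equivalence_rel conn;
    loops_vert : forall t s, ~~ (is_neg (l t) && touch (l t).1 s) ->
      conn (s, t) (s, ordS t);
    loops_lower : forall t s s', is_neg (l t) -> touch (l t).1 s ->
      touch (l t).1 s' -> conn (s, t) (s', t);
    loops_upper : forall t s s', is_neg (l t) -> touch (l t).1 s ->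
      touch (l t).1 s' -> conn (s, ordS t) (s', ordS t);
    loops_sep : forall P : pred ('I_3 * 'I_n),
      (forall t s, ~~ (is_neg (l t) && touch (l t).1 s) ->
         P (s, t) = P (s, ordS t)) ->
      (forall t s s', is_neg (l t) -> touch (l t).1 s -> touch (l t).1 s' ->
         P (s, t) = P (s', t) /\ P (s, ordS t) = P (s', ordS t)) ->
      forall e f, conn e f -> P e = P f
  }.

(** The two edges lie on both sides of the spliced spot for either sign. *)
Definition no_self_loop (n : nat) (l : 'I_n -> letter)
    (conn : rel ('I_3 * 'I_n)) : Prop :=
  forall t, ~~ conn (left_strand (l t).1, t) (right_strand (l t).1, ordS t).

(** The B-state is read as the A-state of the mirror image. *)
Definition state_letter (beta : word) (k : splicing) (t : 'I_(size beta)) :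
    letter :=
  let a := tnth (in_tuple beta) t in
  if k is A_splicing then a else inv_letter a.

Definition level_arcs (beta : word) (k : splicing) (t : 'I_(size beta)) :=
  closure_joins t ++ spliced_arcs k (closure_xing t).

Lemma mem_level_arcs (beta : word) (k : splicing) (t : 'I_(size beta)) e f :
  let: (i, b) := state_letter k t in
  let: (l, r) := (left_strand i, right_strand i) in
  ((e, f) \in level_arcs k t) =
  (e == (e.1, t)) && (f == (e.1, ordS t)) && ~~ touch i e.1
  || ((e, f) \in if b then [:: ((r, t), (r, ordS t)); ((l, ordS t), (l, t))]
                 else [:: ((l, t), (r, t)); ((r, ordS t), (l, ordS t))]).
Proof.
rewrite /state_letter /level_arcs /closure_joins /closure_xing.
have E (i : 'I_2) :
    ((e, f) \in [seq ((s, t), (s, ordS t)) | s <- enum 'I_3 &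
       (s != widen_ord (leqnSn 2) i) && (s != lift ord0 i)]) =
    (e == (e.1, t)) && (f == (e.1, ordS t)) && ~~ touch i e.1.
  apply/mapP/idP => [[s] | /andP [/andP [/eqP e1 /eqP f1] ni]].
    rewrite mem_filter /touch negb_or => /andP [s_out _] [-> ->].
    by rewrite !eqxx.
  exists e.1; last by rewrite {1}e1 {1}f1.
  by rewrite mem_filter mem_enum andbT -negb_or.
case: k; case: (tnth _ t) => i [] /=; rewrite mem_cat E /= !inE //.
  by congr orb; rewrite orbC.
Qed.

Lemma mem_state_arcs (beta : word) (k : splicing)
    (e f : 'I_3 * 'I_(size beta)) :
  reflect (exists t, (e, f) \in @level_arcs beta k t)
          ((e, f) \in state_arcs (braid_closure beta) k).
Proof.
have -> : ((e, f) \in state_arcs (braid_closure beta) k) =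
    ((e, f) \in flatten [seq closure_joins t | t <- enum 'I_(size beta)] ++
       flatten [seq spliced_arcs k x
               | x <- [seq closure_xing t | t <- enum 'I_(size beta)]]) by [].
rewrite -map_comp mem_cat; apply: (iffP orP) => [[] | [t]].
- by move/flatten_mapP => [t _ ef]; exists t; rewrite mem_cat ef.
- by move/flatten_mapP => [t _ ef]; exists t; rewrite mem_cat ef orbT.
by rewrite mem_cat => /orP [] ef; [left | right]; apply/flatten_mapP;
  exists t; rewrite ?mem_enum.
Qed.

Lemma level_arc_same_loop (beta : word) (k : splicing) t e f :
  (e, f) \in @level_arcs beta k t -> @same_loop (braid_closure beta) k e f.
Proof.
move=> ef; apply: connect1; apply/orP; left.
by apply/mem_state_arcs; exists t.
Qed.

Lemma same_loop_sym (D : diagram) (k : splicing) : symmetric (@same_loop D k).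
Proof. by apply: sym_connect_sym => e f; apply: orbC. Qed.

Lemma same_loop_equiv (D : diagram) (k : splicing) :
  equivalence_rel (@same_loop D k).
Proof.
move=> x y z; split; first exact: connect0.
by move=> xy; apply: (same_connect (@same_loop_sym D k) xy).
Qed.

Lemma loops_of_state (beta : word) (k : splicing) :
  loops_of (@state_letter beta k) (@same_loop (braid_closure beta) k).
Proof.
have sym := @same_loop_sym (braid_closure beta) k.
have refl e : @same_loop (braid_closure beta) k e e by exact: connect0.
split.
- exact: (@same_loop_equiv (braid_closure beta) k).
- move=> t s; have A e f := @level_arc_same_loop beta k t e f.
  move: A; have M e f := @mem_level_arcs beta k t e f; move: M.
  case: (state_letter k t) => i b M A; rewrite /is_neg /= negb_and negbK.
  have [/orP [] /eqP -> | nst _] := boolP (touch i s).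
  + by rewrite orbF => b_pos;
      rewrite sym A // M b_pos !inE ?eqxx ?orbT /= ?orbT.
  + by rewrite orbF => b_pos; rewrite A // M b_pos !inE ?eqxx ?orbT /= ?orbT.
  + by rewrite A // M /= !eqxx nst.
- move=> t s s'; have A e f := @level_arc_same_loop beta k t e f.
  move: A; have M e f := @mem_level_arcs beta k t e f; move: M.
  case: (state_letter k t) => i [] //= M A _.
  by case/orP => /eqP ->; case/orP => /eqP ->;
    first [ exact: refl | by rewrite A // M !inE ?eqxx ?orbT /= ?orbT
          | by rewrite sym A // M !inE ?eqxx ?orbT /= ?orbT ].
- move=> t s s'; have A e f := @level_arc_same_loop beta k t e f.
  move: A; have M e f := @mem_level_arcs beta k t e f; move: M.
  case: (state_letter k t) => i [] //= M A _.
  by case/orP => /eqP ->; case/orP => /eqP ->;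
    first [ exact: refl | by rewrite A // M !inE ?eqxx ?orbT /= ?orbT
          | by rewrite sym A // M !inE ?eqxx ?orbT /= ?orbT ].
move=> P vert cupcap e f.
suff closedP : closed (@state_adj (braid_closure beta) k) P.
  exact: closed_connect.
have arcP x y : (x, y) \in state_arcs (braid_closure beta) k -> P x = P y.
  move/mem_state_arcs => [t].
  have := vert t; have := cupcap t; have := @mem_level_arcs beta k t x y.
  case: (state_letter k t) => i b -> /= C V.
  case/orP => [/andP [/andP [/eqP -> /eqP ->] nx] | ].
    by rewrite /= V // (negPf nx) andbF.
  case: b C V => C V; rewrite !inE => /orP [] /eqP [-> ->].
  - exact: V.
  - exact/esym/V.
  - by have [] := C _ _ isT (left_touch i) (right_touch i).
  - by have [] := C _ _ isT (right_touch i) (left_touch i).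
by move=> x y /orP [] /arcP.
Qed.

Lemma semiadequateE (beta : word) :
  semiadequate (braid_closure beta) <->
  exists k, no_self_loop (@state_letter beta k) (@same_loop (braid_closure
    beta) k).
Proof.
have E k : adequate k (braid_closure beta) <->
    no_self_loop (@state_letter beta k) (@same_loop (braid_closure beta) k).
  have [_ vert cup cap _] := loops_of_state beta k.
  set conn := @same_loop (braid_closure beta) k in vert cup cap *.
  have sym : symmetric conn by exact: same_loop_sym.
  have congr a b c d : conn a b -> conn c d -> conn a c = conn b d.
    move=> ab cd; apply: etrans (same_connect sym ab c) _.
    exact: same_connect_r sym _ _ cd _.
  have xingE t : conn (xe0 (closure_xing t)) (xe2 (closure_xing t)) =
      conn (left_strand (state_letter k t).1, t)
           (right_strand (state_letter k t).1, ordS t).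
    move: (vert t) (cup t) (cap t); rewrite /state_letter /closure_xing.
    case: (k); case: (tnth _ t) => i [] //=; rewrite /is_neg /= => V C C'.
      rewrite [RHS]sym; apply: congr; first by apply: V.
      by rewrite sym; apply: V.
    by apply: congr; [apply: C | apply: C']; rewrite ?left_touch ?right_touch.
  rewrite /adequate all_map; split=> [/allP ad t | ad].
    by rewrite -/conn -xingE; apply: ad; rewrite mem_enum.
  by apply/allP => t _; apply: etrans (congr1 negb (xingE t)) (ad t).
rewrite /semiadequate; split=> [/orP [/E | /E] | [[] /E ->]].
- by exists A_splicing.
- by exists B_splicing.
- by [].
by rewrite orbT.
Qed.

(** * Semiadequacy of closed braids *)

Lemma touch_other (i j : 'I_2) : i != j ->
  exists m o, [/\ touch i m, touch j m, touch i o & ~~ touch j o].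
Proof.
case: (gen_cases i) => ->; case: (gen_cases j) => -> // _.
  by exists (left_strand ord_max), (left_strand ord0).
by exists (left_strand ord_max), (right_strand ord_max).
Qed.

Lemma touch_neq (i j : 'I_2) : i != j ->
  touch j (left_strand i) != touch j (right_strand i).
Proof. by case: (gen_cases i) => ->; case: (gen_cases j) => ->. Qed.

Lemma val_iter_ordS (n k : nat) (t : 'I_n) :
  iter k (@ordS n) t = (t + k) %% n :> nat.
Proof.
elim: k => [|k IHk] /=; first by rewrite addn0 modn_small.
by rewrite IHk -addn1 modnDml addn1 addnS.
Qed.

Lemma iter_ordS_onto (n : nat) (t v : 'I_n) : exists k, v = iter k (@ordS n) t.
Proof.
exists (v + (n - t)); apply: val_inj; rewrite /= val_iter_ordS.
by rewrite addnCA subnKC ?modnDr ?modn_small // ltnW.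
Qed.

Section Loops.

Variables (n : nat) (l : 'I_n -> letter) (conn : rel ('I_3 * 'I_n)).
Hypothesis conn_loops : loops_of l conn.

Let conn_refl : reflexive conn.
Proof. by move=> x; have [] := loops_equiv conn_loops x x x. Qed.

Let conn_sym : symmetric conn.
Proof.
move=> x y; apply/idP/idP => xy.
  by have [_ /(_ xy) <-] := loops_equiv conn_loops x y x.
by have [_ /(_ xy) <-] := loops_equiv conn_loops y x y.
Qed.

Let conn_trans : transitive conn.
Proof.
by move=> y x z xy yz; have [_ /(_ xy) ->] := loops_equiv conn_loops x y z.
Qed.

(** Going up from a negative letter, the two strands that its upper arc joins
    stay in the same loop until the next negative letter, where another pair
    takes over. *)
Lemma level_joined (t v : 'I_n) : is_neg (l t) ->
  exists g, forall s s', touch g s -> touch g s' -> conn (s, v) (s', v).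
Proof.
move=> t_neg; have [k ->] := iter_ordS_onto (ordS t) v.
elim: k => [|k [g IHk]] /=.
  by exists (l t).1 => s s'; apply: (loops_upper conn_loops t_neg).
set u := iter k _ _ in IHk *.
have [u_neg | u_pos] := boolP (is_neg (l u)).
  by exists (l u).1 => s s'; apply: (loops_upper conn_loops u_neg).
exists g => s s' gs gs'.
have vert s0 : conn (s0, u) (s0, ordS u).
  by apply: (loops_vert conn_loops); rewrite (negPf u_pos).
apply: conn_trans (vert s'); apply: conn_trans (IHk _ _ gs gs').
by rewrite conn_sym.
Qed.

(** Two adjacent positive letters use both pairs of adjacent strands, and one
    of these pairs is already joined at that level. *)
Lemma no_self_loop_calm : no_self_loop l conn ->
  (forall t, l (ordS t) != inv_letter (l t)) ->
  (exists t, is_neg (l t)) -> forall t, calm (l t) (l (ordS t)).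
Proof.
move=> noloop red [t0 t0_neg] t; apply/contraT => /not_calm [/eqP | ].
  by rewrite (negPf (red t)).
move=> [t_pos t1_pos ij].
have vert s u : (l u).2 -> conn (s, u) (s, ordS u).
  by move=> u_pos; apply: (loops_vert conn_loops); rewrite /is_neg u_pos.
have [g g_conn] := level_joined t t0_neg.
have [gi | gi] := eqVneq g (l t).1.
  case/negP: (noloop t); apply: conn_trans (vert _ _ t_pos).
  by apply: g_conn; rewrite gi ?left_touch ?right_touch.
have gj : g = (l (ordS t)).1.
  by rewrite (ordS2_eq ij) (ordS2_eq (j := g) (i := (l t).1)) // eq_sym.
case/negP: (noloop (ordS t)); apply: conn_trans (vert _ _ t1_pos).
rewrite -gj; apply: conn_trans (vert _ _ t_pos).
have := g_conn _ _ (left_touch g) (right_touch g).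
by apply: conn_trans; rewrite conn_sym vert.
Qed.

(** The path goes from one side of the middle letter to the other along the
    strand that the middle letter does not touch. *)
Lemma no_self_loop_alternating (t : 'I_n) : no_self_loop l conn ->
  ~~ alternating_neg (l t) (l (ordS t)) (l (ordS (ordS t))).
Proof.
move=> noloop; apply/negP => /and5P [a_neg b_neg c_neg ab bc].
set u := ordS t in b_neg c_neg ab bc *; case/negP: (noloop u).
have [m [o [im jm io jo]]] := touch_other ab.
have ca : (l (ordS u)).1 = (l t).1.
  by rewrite (ordS2_eq bc) (ordS2_eq ab) ordS2K.
apply: conn_trans (loops_upper conn_loops b_neg jm (right_touch _)).
have co : conn (o, ordS u) (m, ordS u).
  by apply: (loops_lower conn_loops) => //; rewrite ca.
apply: conn_trans co.
have oo : conn (o, u) (o, ordS u).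
  by apply: (loops_vert conn_loops); rewrite (negPf jo) andbF.
apply: conn_trans oo; apply: conn_trans (loops_upper conn_loops a_neg im io).
exact: (loops_lower conn_loops b_neg (left_touch _) jm).
Qed.

Definition type_gen (c : bool) : 'I_2 := if c then ord_max else ord0.

(** A union of small loops: the strands touched by one generator, over a set of
    levels whose ends are negative letters with that generator. *)
Lemma sep_levels (c : bool) (V : pred 'I_n) :
  (forall t, ~~ is_neg (l t) -> V t = V (ordS t)) ->
  (forall t, is_neg (l t) -> V t || V (ordS t) -> letter_type (l t) = c) ->
  forall e f, conn e f ->
    touch (type_gen c) e.1 && V e.2 = touch (type_gen c) f.1 && V f.2.
Proof.
move=> V_pos V_neg.
have gen t : is_neg (l t) -> V t || V (ordS t) -> (l t).1 = type_gen c.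
  move=> t_neg /(V_neg t t_neg) <-; move: t_neg.
  by case: (letter_cases (l t)) => ->.
apply: (loops_sep conn_loops (P :=
  fun e => touch (type_gen c) e.1 && V e.2)) => /=.
  move=> t s; have [t_neg /= nts | t_pos _] := boolP (is_neg (l t)); last first.
    by rewrite V_pos.
  case: (boolP (V t || V (ordS t))) => [/(gen t t_neg) <- | ].
    by rewrite (negPf nts).
  by rewrite negb_or => /andP [/negPf -> /negPf ->].
move=> t s s' t_neg ts ts'.
case: (boolP (V t || V (ordS t))) => [/(gen t t_neg) <- | ].
  by rewrite ts ts'.
by rewrite negb_or => /andP [/negPf -> /negPf ->]; rewrite !andbF.
Qed.

(** The levels between two letters of the same type carry the small loops of the
    negative letters of this type. *)
Definition coloured (c : bool) (v : 'I_n) : bool :=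
  (letter_type (l (ord_pred v)) == c) && (letter_type (l v) == c).

(** A positive letter joins a strand of a small loop with the remaining strand.
    On at least one side of a negative letter there is a small loop; if there is
    one on both sides, a second negative letter separates them. *)
Lemma calm_no_self_loop :
  (forall t, calm (l t) (l (ordS t))) ->
  (forall t, ~~ alternating_neg (l t) (l (ordS t)) (l (ordS (ordS t)))) ->
  (forall t, exists2 t', t' != t & is_neg (l t')) ->
  no_self_loop l conn.
Proof.
move=> l_calm l_alt l_neg t.
have calm_type u : ~~ (is_neg (l u) && is_neg (l (ordS u))) ->
    letter_type (l (ordS u)) = letter_type (l u).
  by move/negPf => nn; have := l_calm u; rewrite /calm nn orbF => /eqP.
have col_pos c u : ~~ is_neg (l u) -> coloured c u = coloured c (ordS u).
  move=> u_pos; rewrite /coloured ordSK.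
  have -> : letter_type (l (ord_pred u)) = letter_type (l u).
    by have := @calm_type (ord_pred u);
      rewrite ord_predK (negPf u_pos) andbF => ->.
  by rewrite (calm_type u) // (negPf u_pos).
have col_neg c u : coloured c u || coloured c (ordS u) -> letter_type (l u) = c.
  by rewrite /coloured ordSK => /orP [/andP [_ /eqP] | /andP [/eqP]].
pose c := letter_type (l t).
have sep V V_pos V_neg := @sep_levels c V V_pos (fun u _ => V_neg u).
have [t_neg | t_pos] := boolP (is_neg (l t)); last first.
  have t_col : coloured c t.
    rewrite /coloured eqxx andbT.
    have := @calm_type (ord_pred t); rewrite ord_predK (negPf t_pos) andbF.
    by move=> <-.
  have gen : (l t).1 != type_gen c.
    by move: t_pos; rewrite /c; case: (letter_cases (l t)) => ->.
  apply/negP => /(sep _ (col_pos c) (col_neg c)) /=.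
  rewrite -(col_pos c t t_pos) t_col !andbT.
  by move=> /eqP; rewrite (negPf (touch_neq gen)).
have gen : (l t).1 = type_gen c.
  by move: t_neg; rewrite /c; case: (letter_cases (l t)) => ->.
have colE : coloured c t || coloured c (ordS t).
  apply/contraT; rewrite /coloured ordSK eqxx andbT negb_or => /andP [prv nxt].
  case/negP: (l_alt (ord_pred t)); rewrite ord_predK.
  have := l_calm t; have := l_calm (ord_pred t); rewrite ord_predK /calm.
  rewrite /= eq_sym /c in nxt.
  rewrite (negPf prv) (negPf nxt) /= => /andP [p_neg _] /andP [_ n_neg].
  rewrite /alternating_neg p_neg t_neg n_neg /=.
  move: p_neg n_neg t_neg prv nxt; rewrite /c.
  case: (letter_cases (l t)) => ->; case: (letter_cases (l (ord_pred t))) => ->;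
  by case: (letter_cases (l (ordS t))) => ->.
have [t' tt' t'_neg] := l_neg t.
(* When [V t <> V (t + 1)], the two sides of the spliced spot are separated. *)
have sepV V : (forall u, ~~ is_neg (l u) -> V u = V (ordS u)) ->
    (forall u, V u || V (ordS u) -> letter_type (l u) = c) ->
    V t != V (ordS t) ->
    ~~ conn (left_strand (l t).1, t) (right_strand (l t).1, ordS t).
  move=> V_pos V_neg Vt; apply/negP => /(sep _ V_pos V_neg) /=.
  by rewrite gen left_touch right_touch => /eqP; rewrite (negPf Vt).
have [ct | ct] := eqVneq (coloured c t) (coloured c (ordS t)); last first.
  exact: sepV (col_pos c) (col_neg c) ct.
pose arc (v : 'I_n) := (v <= t') (+) (v <= t).
(* An arc of the circle of levels ends only at the letters [t] and [t']. *)
have le_next (v u : 'I_n) : (ordS u <= v) = (u < v) || (u.+1 == n).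
  have [u_lt | u_ge] := ltnP u.+1 n.
    by rewrite /= modn_small // (ltn_eqF u_lt) orbF.
  have un : u.+1 = n by apply/eqP; rewrite eqn_leq u_ge ltn_ord.
  by rewrite /= un modnn eqxx orbT.
have arc_eq u : u != t -> u != t' -> arc u = arc (ordS u).
  rewrite /arc !le_next -!val_eqE /= => ut ut'.
  rewrite (leq_eqVlt u t) (negPf ut) (leq_eqVlt u t') (negPf ut') /=.
  by have := ltn_ord t; have := ltn_ord t'; case: (u.+1 =P n) => un; lia.
have arc_neq : arc t != arc (ordS t).
  rewrite /arc !le_next leqnn ltnn /=.
  move: tt'; rewrite eq_sym -val_eqE /= => tt'.
  by have := ltn_ord t'; case: (t.+1 =P n) => tn; lia.
apply: (sepV (fun v => coloured c v && arc v)).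
- move=> u u_pos; rewrite (col_pos c u u_pos) arc_eq //.
    by apply: contraNneq u_pos => ->.
  by apply: contraNneq u_pos => ->.
- move=> u Vu; apply: (@col_neg c u).
  by case/orP: Vu => /andP [-> _]; rewrite ?orbT.
by move: colE; rewrite -ct orbb => ->.
Qed.

End Loops.

Lemma nth_rot_codom (T : Type) (n : nat) (f : 'I_n -> T) (x0 : T) (t : 'I_n) k :
  k < n -> nth x0 (rot t [seq f i | i <- enum 'I_n]) k = f (iter k (@ordS n) t).
Proof.
move=> k_lt; set s := [seq _ | _ <- _].
have s_size : size s = n by rewrite size_map size_enum_ord.
have s_nth (u : 'I_n) : nth x0 s u = f u by exact: nth_codom_ord.
rewrite -s_nth val_iter_ordS /rot nth_cat size_drop s_size nth_drop.
have t_lt := ltn_ord t; case: (ltnP k (n - t)) => [lt | ge].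
  by rewrite modn_small //; lia.
rewrite nth_take; last by lia.
have {1}-> : t + k = (k - (n - t)) + n by lia.
by rewrite modnDr modn_small //; lia.
Qed.

Lemma cyclic_subword_codom3 (n : nat) (l : 'I_n -> letter) (a b c : letter) :
  2 < n -> cyclic_subword [:: a; b; c] [seq l t | t <- enum 'I_n] =
  [exists t, [&& l t == a, l (ordS t) == b & l (ordS (ordS t)) == c]].
Proof.
move=> n_gt2; set w := [seq _ | _ <- _].
have w_size : size w = n by rewrite size_map size_enum_ord.
have E (t : 'I_n) : prefix [:: a; b; c] (rot t w) =
    [&& l t == a, l (ordS t) == b & l (ordS (ordS t)) == c].
  have rw_size : 2 < size (rot t w) by rewrite size_rot w_size.
  have nth_l k : k < 3 -> nth a (rot t w) k = l (iter k (@ordS n) t).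
    by move=> k_lt; apply: nth_rot_codom; lia.
  rewrite -(nth_l 0) // -(nth_l 1 isT) -(nth_l 2 isT).
  case: (rot t w) rw_size => [|x [|y [|z s]]] //= _.
  by rewrite prefix0s andbT ![_ == a]eq_sym ![_ == b]eq_sym ![_ == c]eq_sym.
clearbody w; subst n; apply: eq_existsb => t; exact: E.
Qed.

Lemma alternating_codomP (n : nat) (l : 'I_n -> letter) : 2 < n ->
  let w := [seq l t | t <- enum 'I_n] in
  reflect (forall t, ~~ alternating_neg (l t) (l (ordS t)) (l (ordS (ordS t))))
    (~~ cyclic_subword word121_inv w && ~~ cyclic_subword word212_inv w).
Proof.
move=> n_gt2 w; rewrite !cyclic_subword_codom3 // -negb_or.
apply: (iffP norP) => [[/existsPn n121 /existsPn n212] t | alt].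
  move: (n121 t) (n212 t).
  case: (letter_cases (l t)) => ->; case: (letter_cases (l (ordS t))) => ->;
  by case: (letter_cases (l (ordS (ordS t)))) => ->.
split; apply/existsPn => t;
  apply: contraNN (alt t) => /and3P [/eqP -> /eqP -> /eqP ->] //.
Qed.

Lemma other_neg_codom (n : nat) (l : 'I_n -> letter) :
  1 < count is_neg [seq l t | t <- enum 'I_n] ->
  forall t, exists2 t', t' != t & is_neg (l t').
Proof.
rewrite count_map => neg_gt1 t.
have : 1 < #|[pred u | is_neg (l u)]|.
  by rewrite cardE /enum_mem size_filter -enumT.
case/card_gt1P => x [y [x_neg y_neg xy]].
have [xt | xt] := eqVneq x t; last by exists x.
by exists y; rewrite // -xt eq_sym.
Qed.

Lemma no_self_loop_efficient (n : nat) (l : 'I_n -> letter) conn :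
  loops_of l conn -> 2 < n ->
  let w := [seq l t | t <- enum 'I_n] in
  cycle (fun a b => b != inv_letter a) w ->
  (cycle calm w -> 1 < count is_neg w) ->
  no_self_loop l conn <-> efficient w.
Proof.
move=> conn_loops n_gt2 w w_red w_neg.
rewrite /efficient /calm_word;
  split=> [noloop | /orP [w_pos | /and3P [w_calm no121 no212]]].
- have [//|] := boolP (all _ w);
    rewrite -has_predC has_map => /hasP [t _ t_neg] /=.
  apply/andP; split.
    apply/cycle_codomP; apply: (no_self_loop_calm conn_loops noloop).
      exact: (elimT (cycle_codomP _ l) w_red).
    by exists t.
  apply/(alternating_codomP _ n_gt2) => u.
  exact: no_self_loop_alternating conn_loops _ noloop.
- have l_pos u : is_neg (l u) = false.
    by apply/negbF; apply: (allP w_pos); rewrite map_f ?mem_enum.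
  move=> t; apply/negP.
  move/(loops_sep conn_loops (P := fun e => e.1 == left_strand (l t).1)) => /=.
  rewrite eqxx; suff -> : (right_strand (l t).1 == left_strand (l t).1) = false.
    by move=> E; have : true = false by apply: E => // u s s'; rewrite l_pos.
  by case: (gen_cases (l t).1) => ->.
- apply: (calm_no_self_loop conn_loops).
  + exact/cycle_codomP.
  + by apply/(alternating_codomP _ n_gt2); rewrite no121.
  exact/other_neg_codom/w_neg.
Qed.

Lemma semiadequate_efficient (beta : word) (q : seq int) :
  schreier_vector beta q -> 2 < size q ->
  semiadequate (braid_closure beta) <->
    efficient beta || efficient (mirror beta).
Proof.
move=> beta_q q_gt2.
pose w k := [seq @state_letter beta k t | t <- enum 'I_(size beta)].
have wA : w A_splicing = beta.
  by rewrite /w map_tnth_enum.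
have wB : w B_splicing = mirror beta.
  by rewrite -[in RHS]wA /mirror -map_comp.
have beta_size : 2 < size beta.
  apply: leq_trans q_gt2 _; move: beta_q => [q_n0 _ [p [m E]]].
  rewrite -(size_rot m beta) E; elim: q p q_n0 {E} => //= a q IHq p.
  rewrite inE negb_or eq_sym -absz_gt0 => /andP [a_n0 /(IHq (ordS p)) {}IHq].
  by rewrite size_cat size_nseq -add1n leq_add.
have E k : no_self_loop (@state_letter beta k) (@same_loop (braid_closure beta)
  k)
    <-> efficient (w k).
  apply: no_self_loop_efficient beta_size _ _; first exact: loops_of_state.
  + rewrite -/(w k); case: k; rewrite ?wA ?wB.
      exact: schreier_reduced beta_q.
    exact: schreier_reduced (schreier_vector_mirror beta_q).
  rewrite -/(w k); case: k; rewrite ?wA ?wB.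
    exact: cycle_calm_count_neg beta_q _.
  apply: cycle_calm_count_neg (schreier_vector_mirror beta_q) _.
  by rewrite size_map.
apply: (iff_trans (semiadequateE beta)).
split=> [[[] /E] | /orP [] eff].
- by rewrite wA => ->.
- by rewrite wB => ->; rewrite orbT.
- by exists A_splicing; apply/E; rewrite wA.
by exists B_splicing; apply/E; rewrite wB.
Qed.

(** * A representation of the braid group *)

Local Open Scope ring_scope.

(** With [S^2 = 1] and [T^3 = 1], the images of [Delta] and of
    [sigma1 sigma2] are [S] and [T]. *)
Definition letter_image (A : nzRingType) (S T : A) (a : letter) : A :=
  match a.1 == ord_max, a.2 with
  | false, true => T * T * S
  | true, true => S * (T * T)
  | false, false => S * T
  | true, false => T * S
  end.

Lemma braid_eq_image (A : nzRingType) (S T : A) (u v : word) :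
  S * S = 1 -> T * T * T = 1 -> braid_eq u v ->
  \prod_(a <- u) letter_image S T a = \prod_(a <- v) letter_image S T a.
Proof.
move=> SS TTT.
have ST x : S * (S * x) = x by rewrite mulrA SS mul1r.
have TTx x : T * (T * (T * x)) = x by rewrite !mulrA TTT mul1r.
have TTT' : T * (T * T) = 1 by rewrite mulrA.
elim=> {u v} [//|u v _ -> //|u v w _ -> _ -> //|u u' v v' _ E1 _ E2|a|].
- by rewrite !big_cat /= E1 E2.
- rewrite !big_cons big_nil mulr1.
  by case: (letter_cases a) => ->; rewrite /letter_image /= -!mulrA
    !(ST, TTx, SS, TTT').
by rewrite !big_cons big_nil mulr1 /letter_image /= -!mulrA
  !(ST, TTx, SS, TTT', mulr1).
Qed.

Lemma coef_mul_lead (A : nzRingType) (p q : {poly A}) (m n : nat) :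
  (size p <= m.+1)%N -> (size q <= n.+1)%N -> (p * q)`_(m + n) = p`_m * q`_n.
Proof.
move=> p_size q_size; have m_lt : (m < (m + n).+1)%N by lia.
rewrite coefM (bigD1 (Ordinal m_lt)) //= addKn big1 ?addr0 // => i.
rewrite -val_eqE /= neq_ltn => /orP [i_lt | i_gt].
  by rewrite [q`_ _]nth_default ?mulr0 //; apply: leq_trans q_size _; lia.
by rewrite nth_default ?mul0r //; apply: leq_trans p_size _.
Qed.

Lemma trace_coef_mulC (n k : nat) (p q : {poly 'M[int]_n.+1}) :
  \tr (p * q)`_k = \tr (q * p)`_k.
Proof.
rewrite coefM coefMr !linear_sum /=; apply: eq_bigr => i _.
exact: mxtrace_mulC.
Qed.

Definition mx3 (rows : seq (seq int)) : 'M[int]_3 :=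
  \matrix_(i, j) nth 0 (nth [::] rows i) j.

(** The leading coefficient of [cube_root] is nilpotent of order 3, so its
    square has degree exactly 2.  The involution is chosen so that its products
    with this coefficient and with its square are nonnegative on the last two
    coordinates. *)
Definition invol : 'M[int]_3 :=
  mx3 [:: [:: -1; 0; 0]; [:: 2; 1; 0]; [:: 2; 2; -1]].
Definition cube_root1 : 'M[int]_3 :=
  mx3 [:: [:: 0; 1; 0]; [:: 0; 0; 1]; [:: 0; 0; 0]].
Definition cube_root0 : 'M[int]_3 :=
  mx3 [:: [:: 0; 0; -1]; [:: 1; 0; 0]; [:: 0; -1; 0]].

Lemma mul_mx3 (x y z : seq int) (x' y' z' : seq int) :
  mx3 [:: x; y; z] * mx3 [:: x'; y'; z'] =
  mx3 [seq [seq nth 0 r 0 * nth 0 x' k + nth 0 r 1 * nth 0 y' k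
            + nth 0 r 2 * nth 0 z' k | k <- [:: 0; 1; 2]%N] | r <- [:: x; y;
                z]].
Proof.
apply/matrixP => i j; rewrite !mxE !big_ord_recl big_ord0 !mxE addr0 addrA.
by case: i => [[|[|[|//]]] ?]; case: j => [[|[|[|//]]] ?].
Qed.

Lemma mx3_1 : 1 = mx3 [:: [:: 1; 0; 0]; [:: 0; 1; 0]; [:: 0; 0; 1]].
Proof.
by apply/matrixP => i j; rewrite !mxE;
  case: i => [[|[|[|//]]] ?]; case: j => [[|[|[|//]]] ?].
Qed.

Lemma invol2 : invol * invol = 1.
Proof. by rewrite mul_mx3 mx3_1. Qed.

Definition cube_root : {poly 'M[int]_3} := cube_root0%:P + cube_root1%:P * 'X.

Lemma coef_cube_root_mul (p : {poly 'M[int]_3}) (k : nat) :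
  (cube_root * p)`_k = cube_root0 * p`_k + (if k is j.+1 then cube_root1 * p`_j
    else 0).
Proof.
rewrite /cube_root mulrDl coefD coefCM -mulrA -commr_polyX mulrA.
by case: k => [|k]; rewrite coefMX //= coefCM.
Qed.

Lemma coef_cube_root (k : nat) :
  cube_root`_k = match k with 0 => cube_root0 | 1 => cube_root1 | _ => 0 end.
Proof.
rewrite /cube_root coefD coefC coefMX.
by case: k => [|[|k]]; rewrite /= ?coefC /= ?addr0 ?add0r.
Qed.

Lemma cube_root_cube : cube_root * cube_root * cube_root = 1.
Proof.
rewrite -mulrA; apply/polyP => k; rewrite !coef_cube_root_mul coef1.
have add_mx3 x y z x' y' z' : mx3 [:: x; y; z] + mx3 [:: x'; y'; z'] =
  mx3 [seq [seq nth 0 r.1 k + nth 0 r.2 k | k <- [:: 0; 1; 2]%N]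
      | r <- [:: (x, x'); (y, y'); (z, z')]].
  by apply/matrixP => i j; rewrite !mxE;
    case: i => [[|[|[|//]]] ?]; case: j => [[|[|[|//]]] ?].
have mx3_0 : 0 = mx3 [:: [:: 0; 0; 0]; [:: 0; 0; 0]; [:: 0; 0; 0]].
  by apply/matrixP => i j; rewrite !mxE;
    case: i => [[|[|[|//]]] ?]; case: j => [[|[|[|//]]] ?].
case: k => [|[|[|[|k]]]]; rewrite ?coef_cube_root_mul !coef_cube_root /=
  ?(mulr0, addr0, add0r) //.
- by rewrite !mul_mx3 mx3_1.
- by rewrite !(mul_mx3, add_mx3) -mx3_0.
- by rewrite !(mul_mx3, add_mx3) -mx3_0.
- by rewrite !mul_mx3 -mx3_0.
Qed.

Definition braid_mx (w : word) : {poly 'M[int]_3} :=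
  \prod_(a <- w) letter_image invol%:P cube_root a.

Lemma braid_mx_eq (u v : word) : braid_eq u v -> braid_mx u = braid_mx v.
Proof.
by apply: braid_eq_image cube_root_cube; rewrite -polyCM invol2.
Qed.

Lemma trace_braid_conj (u v : word) (k : nat) : braid_conj u v ->
  \tr (braid_mx v)`_k = \tr (braid_mx u)`_k.
Proof.
case=> w /braid_mx_eq ->.
rewrite /braid_mx big_cat /= trace_coef_mulC big_cat /= -mulrA -big_cat /=.
by rewrite -/(braid_mx (w ++ _)) (braid_mx_eq (braid_eq_mulV w)) /braid_mx
  big_nil mulr1.
Qed.

Definition cost (w : word) : nat := \sum_(a <- w) (a.2).+1.

Definition letter_lead (a : letter) : 'M[int]_3 :=
  letter_image invol cube_root1 a.

Lemma size_cube_root : (size cube_root <= 2)%N.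
Proof. by apply/leq_sizeP => [[|[|k]]] // _; rewrite coef_cube_root. Qed.

Lemma letter_image_lead (a : letter) :
  (size (letter_image invol%:P cube_root a) <= (a.2).+2)%N /\
  (letter_image invol%:P cube_root a)`_(a.2).+1 = letter_lead a.
Proof.
have S_size : (size (invol%:P : {poly 'M[int]_3}) <= 1)%N by exact:
  size_polyC_leq1.
have S_top : (invol%:P : {poly 'M[int]_3})`_0 = invol by rewrite coefC.
have mul (p q : {poly 'M[int]_3}) (m n : nat) (x y : 'M[int]_3) :
    (size p <= m.+1)%N /\ p`_m = x -> (size q <= n.+1)%N /\ q`_n = y ->
    (size (p * q)%R <= (m + n).+1)%N /\ (p * q)`_(m + n) = x * y.
  move=> [p_size <-] [q_size <-]; rewrite coef_mul_lead //; split=> //.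
  by apply: leq_trans (size_polyMleq _ _) _; lia.
have S_lead := conj S_size S_top.
have T_lead := conj size_cube_root (coef_cube_root 1).
have TT_lead := mul _ _ _ _ _ _ T_lead T_lead.
case: (letter_cases a) => ->; rewrite /letter_lead /letter_image /=.
- exact: mul _ _ _ _ _ _ TT_lead S_lead.
- exact: mul _ _ _ _ _ _ S_lead TT_lead.
- exact: mul _ _ _ _ _ _ S_lead T_lead.
- exact: mul _ _ _ _ _ _ T_lead S_lead.
Qed.

Lemma size_braid_mx (w : word) : (size (braid_mx w) <= (cost w).+1)%N.
Proof.
rewrite /braid_mx /cost; elim: w => [|a w IHw].
  by rewrite !big_nil size_poly1.
rewrite !big_cons; apply: leq_trans (size_polyMleq _ _) _.
have [a_size _] := letter_image_lead a; move: IHw a_size.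
by move: (size _) (size _) (a.2).+1 (\sum_(_ <- _) _) => *; lia.
Qed.

Lemma braid_mx_lead (w : word) :
  (braid_mx w)`_(cost w) = \prod_(a <- w) letter_lead a.
Proof.
elim: w => [|a w IHw].
  by rewrite /braid_mx /cost !big_nil coef1.
have := size_braid_mx w; have [a_size a_top] := letter_image_lead a.
rewrite /braid_mx /cost !big_cons => w_size.
by rewrite coef_mul_lead // a_top IHw.
Qed.

(** * Words of minimal length *)

(** Conjugation by [invol] exchanges the two types of letters; this is the
    change of coordinates in which all letters of one type act in the same
    way. *)
Definition frame (c : bool) : 'M[int]_3 := if c then invol else 1.

Definition cone (a b : int) : 'rV[int]_3 := \row_j nth 0 [:: 0; a; b] j.

Lemma cone_mul (a b : int) (x y z : seq int) :
  cone a b *m mx3 [:: x; y; z] = \row_j (a * nth 0 y j + b * nth 0 z j).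
Proof.
apply/rowP => j; rewrite !mxE !big_ord_recl big_ord0 !mxE /= mul0r add0r addr0.
by [].
Qed.

Lemma cone_cube_root1 (a b : int) : cone a b *m cube_root1 = cone 0 a.
Proof.
rewrite cone_mul; apply/rowP => j; rewrite !mxE.
by case: j => [[|[|[|//]]] ?] /=; ring.
Qed.

Lemma cone_neg (a b : int) :
  cone a b *m (invol * cube_root1) = cone (2 * a + 2 * b) (a + 2 * b).
Proof.
rewrite mul_mx3 cone_mul; apply/rowP => j; rewrite !mxE.
by case: j => [[|[|[|//]]] ?] /=; ring.
Qed.

Lemma cone_pos (a b : int) :
  cone a b *m (invol * (cube_root1 * cube_root1)) = cone 0 (2 * a + 2 * b).
Proof.
rewrite !mul_mx3 cone_mul; apply/rowP => j; rewrite !mxE.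
by case: j => [[|[|[|//]]] ?] /=; ring.
Qed.

Lemma frame_same (y : letter) :
  letter_lead y *m frame (letter_type y) =
  frame (letter_type y) *m (if y.2 then invol * (cube_root1 * cube_root1) else
    invol * cube_root1).
Proof.
have S2 (x : 'M[int]_3) : invol * (invol * x) = x by rewrite mulrA invol2 mul1r.
by case: (letter_cases y) => ->; rewrite /letter_lead /letter_image /frame /=
  ?mulmx1 ?mul1mx //; rewrite -[LHS]mulrA invol2 mulr1; apply/esym/S2.
Qed.

(** At a change of type the two involutions cancel.  This is the reduction
    [T S S T = T^2]. *)
Lemma frame_cross (y : letter) : is_neg y ->
  letter_lead y *m frame (letter_type y) =
    frame (~~ letter_type y) *m cube_root1.
Proof.
by case: (letter_cases y) => -> // _;
  rewrite /letter_lead /letter_image /frame /=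
  ?mulmx1 ?mul1mx // -[LHS]mulrA invol2 mulr1.
Qed.

(** The letters [w] may follow [x]: the type changes only between negative
    letters, and never directly after a locked letter, that is, one which is
    positive or has itself just changed the type. *)
Fixpoint steady (x : letter) (locked : bool) (w : word) : bool :=
  if w is y :: w' then
    if letter_type y == letter_type x then steady y y.2 w'
    else [&& ~~ locked, is_neg y & steady y true w']
  else true.

(** After a locked letter the first cone coordinate may vanish, and then a
    change of type would send the vector to zero. *)
Lemma steady_cone (w : word) (x : letter) (locked : bool) (u : 'rV[int]_3) a b :
  steady x locked w -> u *m frame (letter_type x) = cone a b ->
  0 <= a -> 0 < b -> (~~ locked -> 0 < a) ->
  exists a' b', [/\ u *m \prod_(y <- w) letter_lead y
                      *m frame (letter_type (last x w)) = cone a' b',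
                    0 <= a' & 0 < b'].
Proof.
elim: w x locked u a b => [|y w IHw] x locked u a b.
  by rewrite big_nil mulmx1 => _ ux a_ge0 b_gt0 _; exists a, b.
rewrite big_cons /= -[letter_lead y * _]/(letter_lead y *m _) mulmxA.
have [yx y_ok | yx /and3P [free y_neg y_ok]] := eqVneq (letter_type y) _.
  rewrite -yx => ux a_ge0 b_gt0 a_gt0.
  have uy : u *m letter_lead y *m frame (letter_type y) =
      cone a b *m (if y.2 then invol * (cube_root1 * cube_root1) else invol *
        cube_root1).
    by rewrite -mulmxA frame_same mulmxA ux.
  case: y.2 y_ok uy => y_ok; rewrite ?cone_pos ?cone_neg => uy.
    by apply: IHw y_ok uy _ _ _ => //; lia.
  by apply: IHw y_ok uy _ _ _ => //; lia.
move=> ux a_ge0 b_gt0 /(_ free) a_gt0.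
apply: IHw y_ok _ (lexx 0) a_gt0 _ => //.
rewrite -mulmxA frame_cross // mulmxA -(cone_cube_root1 a b) -ux.
by case: (letter_type y) (letter_type x) yx => [] [].
Qed.

Definition unalternating (w : word) : Prop :=
  forall s1 a b c s2, w = s1 ++ [:: a, b, c & s2] ->
  ~~ alternating_neg a b c.

Lemma steady_calm (s : word) (z x : letter) :
  path calm z (x :: s) -> unalternating [:: z, x & s] ->
  steady x (x.2 || (letter_type z != letter_type x)) s.
Proof.
elim: s z x => //= y s IHs z x /and3P [zx xy ys] zxy.
have xys : steady y (y.2 || (letter_type x != letter_type y)) s.
  apply: IHs; first by rewrite /= xy.
  by move=> s1 a b c s2 E; apply: (zxy (z :: s1) a b c s2); rewrite E.
have [yx | yx] := eqVneq (letter_type y) (letter_type x).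
  by move: xys; rewrite yx eqxx orbF.
move: xys; rewrite eq_sym yx orbT => ->; rewrite andbT.
move: xy; rewrite /calm eq_sym (negPf yx) /= => /andP [x_neg y_neg];
  rewrite y_neg andbT.
move: (x_neg); rewrite /is_neg => /negPf -> /=; apply/negP => zx_neq.
move: zx; rewrite /calm (negPf zx_neq) /= => /andP [z_neg _].
case/negP: (zxy [::] z x y s erefl).
move: z_neg x_neg y_neg yx zx_neq.
by case: (letter_cases z) => ->; case: (letter_cases x) => ->;
  case: (letter_cases y) => ->.
Qed.

Lemma calm_word_unalternating (w : word) : calm_word w -> unalternating w.
Proof.
case/and3P => _ /negP no121 /negP no212 s1 a b c s2 w_def.
have abc : cyclic_subword [:: a; b; c] w.
  apply/cyclic_subwordP; exists (size s1), (s2 ++ s1).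
  by rewrite w_def rot_size_cat.
move: abc no121 no212; rewrite /alternating_neg.
by case: (letter_cases a) => ->; case: (letter_cases b) => ->;
  case: (letter_cases c) => ->.
Qed.

(** The leading matrix of the positive letter [x] is a column times a row, so
    the trace is the image of this row under the leading matrices of [s],
    evaluated on the column. *)
Lemma trace_lead_gt0 (x : letter) (s : word) :
  x.2 -> calm_word (x :: s) -> 0 < \tr (\prod_(a <- x :: s) letter_lead a).
Proof.
move=> x_pos xs_calm; set c := letter_type x.
have last_type y : calm y x -> letter_type y = c.
  by rewrite /calm /is_neg x_pos andbF orbF => /eqP.
have first_type y : calm x y -> letter_type y = c.
  by rewrite /calm /is_neg x_pos orbF => /eqP.
have /and3P [/= xs_path _ _] := xs_calm.
have s_steady : steady x true s.
  have := calm_word_unalternating xs_calm; move: xs_path; rewrite rcons_path.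
  case: s {xs_calm} => //= y s /andP [/andP [xy ys] _] xys.
  rewrite (first_type y xy) eqxx.
  have := @steady_calm s x y; rewrite (first_type y xy) eqxx orbF; apply=> //.
  by rewrite /= xy.
pose e : 'rV[int]_3 := cone 0 1 *m frame c.
have frame2 : frame c *m frame c = 1%:M.
  by rewrite /frame; case: c {first_type last_type e};
    [apply: invol2 | rewrite mulmx1].
have e_frame : e *m frame (letter_type x) = cone 0 1.
  by rewrite /e -mulmxA frame2 mulmx1.
have [a [b [ab a_ge0 b_gt0]]] :=
  steady_cone s_steady e_frame (lexx 0) ltr01 (fun H => H).
have {}ab : e *m (\prod_(y <- s) letter_lead y) *m frame c = cone a b.
  rewrite -ab last_type //; move: xs_path; rewrite rcons_path.
  by case/andP.
pose col : 'cV[int]_3 := \col_i nth 0 [:: -1; 2; 2] i.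
(* The image of a positive letter has a leading matrix of rank one. *)
have col_row : invol * (cube_root1 * cube_root1) = col *m cone 0 1.
  rewrite !mul_mx3; apply/matrixP => i j; rewrite !mxE big_ord1 !mxE.
  case: i => [[|[|[|//]]] ?]; case: j => [[|[|[|//]]] ?] /=; ring.
have x_top : letter_lead x = frame c *m col *m e.
  rewrite -[LHS]mulmx1 -frame2 mulmxA frame_same x_pos col_row.
  by rewrite /e !mulmxA.
rewrite big_cons x_top -[_ * _]/(_ *m _) -!mulmxA mulmxA mxtrace_mulC !mulmxA
  ab.
rewrite /mxtrace big_ord1 mxE !big_ord_recl big_ord0 !mxE /=; lia.
Qed.

Definition exponent_sum (w : word) : int :=
  \sum_(a <- w) (if a.2 then 1 else -1).

Lemma exponent_sum_cons (a : letter) (w : word) :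
  exponent_sum (a :: w) = (if a.2 then 1 else -1) + exponent_sum w.
Proof. exact: big_cons. Qed.

Lemma exponent_sum_eq (u v : word) :
  braid_eq u v -> exponent_sum u = exponent_sum v.
Proof.
rewrite /exponent_sum.
elim=> {u v} [//|u v _ -> //|u v w _ -> _ -> //|u u' v v' _ E1 _ E2|[i b]|].
- by rewrite !big_cat /= E1 E2.
- by rewrite !big_cons big_nil; case: b.
by rewrite !big_cons big_nil.
Qed.

Lemma exponent_sum_conj (u v : word) :
  braid_conj u v -> exponent_sum v = exponent_sum u.
Proof.
case=> w /exponent_sum_eq ->; rewrite /exponent_sum !big_cat /=.
have := exponent_sum_eq (braid_eq_mulV w).
rewrite /exponent_sum big_cat big_nil /= => E.
by rewrite addrCA [X in _ + X]addrC E addr0.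
Qed.

Lemma size_cost (w : word) :
  (cost w)%:Z *+ 2 = (size w)%:Z *+ 3 + exponent_sum w.
Proof.
elim: w => [|[i b] w IHw]; first by rewrite /cost /exponent_sum !big_nil.
have -> : cost ((i, b) :: w) = (b.+1 + cost w)%N by exact: big_cons.
by rewrite exponent_sum_cons /=; move: (cost w) IHw; case: b => *; lia.
Qed.

Lemma exponent_sum_le (w : word) : `|exponent_sum w| <= (size w)%:Z.
Proof.
elim: w => [|[i b] w IHw]; first by rewrite /exponent_sum big_nil.
by rewrite exponent_sum_cons /=; case: b; lia.
Qed.

Lemma exponent_sum_pos (w : word) :
  all (fun a => a.2) w -> exponent_sum w = (size w)%:Z.
Proof.
elim: w => [|a w IHw] /=; first by rewrite /exponent_sum big_nil.
by rewrite exponent_sum_cons => /andP [-> /IHw ->]; lia.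
Qed.

Lemma exponent_sum_neg (w : word) :
  all is_neg w -> exponent_sum w = - (size w)%:Z.
Proof.
elim: w => [|a w IHw] /=; first by rewrite /exponent_sum big_nil.
by rewrite exponent_sum_cons => /andP [/negPf -> /IHw ->]; lia.
Qed.

(** A word with letters of one sign only is minimal by its exponent sum.  In the
    other cases the cost is the degree of the trace, and for a given exponent sum
    the length grows with the cost. *)
Lemma efficient_min_length (w : word) :
  efficient w -> min_length_in_conj_class w.
Proof.
move=> w_eff v wv; have v_sum := exponent_sum_conj wv.
have v_le := exponent_sum_le v.
have [w_neg | w_pos] := boolP (all is_neg w).
  by have := exponent_sum_neg w_neg; lia.
case/orP: w_eff => [/exponent_sum_pos | w_calm]; first by lia.
have /hasP [x xw x_pos] : has (fun a => a.2) w.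
  move: w_pos; rewrite -has_predC; apply: etrans.
  by apply: eq_has => a; rewrite /= negbK.
have [m s w_rot] := rot_to xw.
have trace_neq0 : \tr (braid_mx w)`_(cost w) != 0.
  rewrite -(trace_braid_conj _ (braid_conj_rot m w)).
  have -> : cost w = cost (rot m w).
    by rewrite /cost; apply/perm_big; rewrite perm_sym perm_rot.
  rewrite braid_mx_lead w_rot; apply: lt0r_neq0; apply: trace_lead_gt0 x_pos _.
  by rewrite -w_rot calm_word_rot.
have cost_le : (cost w <= cost v)%N.
  rewrite leqNgt; apply: contraNN trace_neq0 => cost_lt.
  rewrite -(trace_braid_conj _ wv) nth_default ?mxtrace0 //.
  by apply: leq_trans (size_braid_mx v) _.
by have := size_cost w; have := size_cost v; lia.
Qed.

Local Close Scope ring_scope.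

Theorem theorem6p1 (beta : word) (q : seq int)
  (beta_q : schreier_vector beta q) (q_gt2 : (2 < size q)%N) :
  let cond_a := is_true (semiadequate (braid_closure beta)) in
  let cond_b := min_length_in_conj_class beta in
  let cond_c :=
    exists (gamma : word) (r : seq int),
      [/\ gamma = beta \/ gamma = mirror beta,
          schreier_vector gamma r
        & is_true (positive_vector r)
          \/ [/\ ~~ cyclic_subword word121_inv gamma,
                 ~~ cyclic_subword word212_inv gamma
               & positive_entries_isolated r]] in
  (cond_a <-> cond_b) /\ (cond_b <-> cond_c).
Proof.
move=> cond_a cond_b cond_c.
have a_eff : cond_a <-> efficient beta || efficient (mirror beta).
  exact: semiadequate_efficient beta_q q_gt2.
have c_eff : cond_c <-> efficient beta || efficient (mirror beta).
  exact: efficient_vectorP beta_q.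
have b_eff : cond_b <-> efficient beta || efficient (mirror beta).
  split; first exact: min_length_efficient.
  case/orP => /efficient_min_length //.
  by move/min_length_mirror; rewrite mirrorK.
split; first exact: iff_trans a_eff (iff_sym b_eff).
exact: iff_trans b_eff (iff_sym c_eff).
Qed.
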